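(* Let $\mathcal{P}\subseteq\Delta(\Omega,\mathcal{F})$ be a nonempty set of countably additive probability measures and let $A\in\mathcal{F}$. Let $X$ be a simple random variable, i.e. one for which the index set $\mathcal{I}$ of its sample space $\mathbf{X}=\{X=x_i\}_{i\in\mathcal{I}}$ is finite with $P$-probability $1$ for all $P\in\mathcal{P}$. Then generalized Bayes' updating on the value of $X$ does not weakly pointwise constrict $A$.
   Context: $\Delta(\Omega,\mathcal{F})$ is the space of countably additive probability measures on a measurable space $(\Omega,\mathcal{F})$. For a set $\mathcal{P}\subseteq\Delta(\Omega,\mathcal{F})$ (not necessarily closed or convex), $\underline{P}(A)=\inf_{P\in\mathcal{P}}P(A)$ and $\overline{P}(A)=\sup_{P\in\mathcal{P}}P(A)$. $X:\Omega\to\mathbb{R}$ is a random variable measurable with respect to every $P\in\mathcal{P}$, and $\mathbf{X}=\{X=x_i\}_{i\in\mathcal{I}}$ is its sample space of measurable events. Write $\underline{P}(A\mid X=x_i)=\inf_{P\in\mathcal{P}}P(A\mid X=x_i)$ and $\overline{P}(A\mid X=x_i)=\sup_{P\in\mathcal{P}}P(A\mid X=x_i)$ for the bounds after generalized Bayes' updating. It is assumed that the $P$'s in $\mathcal{P}$ agree on those outcomes $\{X=x_i\}$ that are $P$-null. Generalized Bayes' updating strictly pointwise constricts $A$ if, for each $x_i$ in a set having $P$-probability $1$ for all $P\in\mathcal{P}$, $\underline{P}(A)<\underline{P}(A\mid X=x_i)$ and $\overline{P}(A)>\overline{P}(A\mid X=x_i)$. It weakly pointwise constricts $A$ if this holds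 with one of the two inequalities replaced by its weak version; that is, there is a set of outcomes having $P$-probability $1$ for all $P\in\mathcal{P}$ such that either [$\underline{P}(A)<\underline{P}(A\mid X=x_i)$ and $\overline{P}(A)\ge\overline{P}(A\mid X=x_i)$ for each $x_i$ in the set], or [$\underline{P}(A)\le\underline{P}(A\mid X=x_i)$ and $\overline{P}(A)>\overline{P}(A\mid X=x_i)$ for each $x_i$ in the set]. *)

(* Defs.v *)
(* MathComp-Analysis. *)
From HB Require Import structures.
From mathcomp Require Import all_boot all_order all_algebra.
From mathcomp Require Import all_classical all_reals all_analysis.
Set Implicit Arguments.
Unset Strict Implicit.
Unset Printing Implicit Defensive.
Import Order.TTheory GRing.Theory Num.Theory.
Local Open Scope classical_set_scope.
Local Open Scope ring_scope.

Section Imprecise.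
Context (d : measure_display) (T : measurableType d) (R : realType).
Implicit Types (P : probability T R) (PP : set (probability T R)).
Implicit Types (A : set T) (X : {mfun T >-> R}) (x : R).

Definition event_eq X x : set T := X @^-1` [set x].

(* Meaningful only when {X = x} is not P-null (division by 0 yields 0). *)
Definition cond_prob P A X x : R :=
  fine (P (A `&` event_eq X x)) / fine (P (event_eq X x)).

Definition lower_prob PP A : R := inf [set fine (P A) | P in PP].
Definition upper_prob PP A : R := sup [set fine (P A) | P in PP].

Definition lower_cond PP A X x : R := inf [set cond_prob P A X x | P in PP].
Definition upper_cond PP A X x : R := sup [set cond_prob P A X x | P in PP].

Definition agree_on_null PP X : Prop :=
  forall P Q, PP P -> PP Q -> forall x,
    P (event_eq X x) = 0%E -> Q (event_eq X x) = 0%E.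

(* One finite set of values, common to all P, carries X almost surely. *)
Definition simple_rv PP X : Prop :=
  exists2 I : set R, finite_set I & forall P, PP P -> P (X @^-1` I) = 1%E.

(* S is a set of outcomes having P-probability 1 for every P in PP. The bounds
   after updating on {X = x} are only defined when {X = x} is non-null, so S
   consists of such outcomes. For a simple X and a PP that agrees on null
   outcomes this is no restriction: deleting the null values from a set of
   values of probability 1 leaves its probability equal to 1. *)
Definition sure_outcomes PP X (S : set R) : Prop :=
  [/\ measurable S,
      forall P, PP P -> P (X @^-1` S) = 1%E &
      forall x, S x -> forall P, PP P -> P (event_eq X x) != 0%E].

Definition weakly_pointwise_constricts PP X A : Prop :=
  exists2 S : set R, sure_outcomes PP X S &
    (forall x, S x -> lower_prob PP A < lower_cond PP A X x /\
                      upper_prob PP A >= upper_cond PP A X x) \/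
    (forall x, S x -> lower_prob PP A <= lower_cond PP A X x /\
                      upper_prob PP A > upper_cond PP A X x).

End Imprecise.

(* Main.v *)
Require Import Defs.
From mathcomp Require Import all_boot all_order all_algebra.
From mathcomp Require Import all_classical all_reals all_analysis.
Import Order.TTheory GRing.Theory Num.Theory.
Local Open Scope classical_set_scope.
Local Open Scope ring_scope.

(** By the law of total probability P(A) is a convex combination of the
    P(A | X = x) over the finitely many non-null outcomes x. If every
    lower conditional probability exceeds the lower probability of A, then so
    does their minimum m, as there are finitely many x; but P(A) >= m for all
    P, so the lower probability of A is at least m. Upper probabilities are
    dual. *)

Lemma finite_gt_bound (R : realDomainType) (I : choiceType) (J : set I)
    (f : I -> R) (a : R) :
  finite_set J -> (forall x, J x -> a < f x) ->
  exists2 m, a < m & forall x, J x -> m <= f x.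
Proof.
move=> /finite_seqP[s ->].
(* [J] may be empty, and then any number above [a] serves as [m]; [a + 1] is taken. *)
elim: s => [|y s IHs] af; first by exists (a + 1) => //; rewrite ltrDl.
have [|m am mf] := IHs.
  by move=> x /= xs; apply: af => /=; rewrite inE xs orbT.
exists (Order.min m (f y)).
  by rewrite lt_min am; apply: af; rewrite /= mem_head.
move=> x /=; rewrite inE ge_min => /orP[/eqP->|xs]; first by rewrite lexx orbT.
by rewrite mf.
Qed.

Section ConditionalMeans.
Context (d : measure_display) (T : measurableType d) (R : realType).
Implicit Types (P : probability T R) (PP : set (probability T R)).
Implicit Types (A B : set T) (X : {mfun T >-> R}) (J : set R).

(** The complement of [B] is null, so the part of [A] outside [B] carries no mass. *)
Lemma probability_setI_sure P A B :
  measurable A -> measurable B -> P B = 1%E -> P (A `&` B) = P A.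
Proof.
move=> mA mB PB1.
have PBC : P (~` B) = 0%E by rewrite probability_setC // PB1 subee.
have ABC0 : P (A `&` ~` B) = 0%E.
  apply/eqP; rewrite eq_le measure_ge0 andbT -PBC.
  by apply: measureIr => //; exact: measurableC.
rewrite -[in RHS](setUIDK A B) setDE measureU0 //; first exact: measurableI.
by apply: measurableI => //; exact: measurableC.
Qed.

Lemma measurable_event_eq X x : measurable (event_eq X x).
Proof. by rewrite /event_eq -[_ @^-1` _]setTI; exact: measurable_funPT. Qed.

Lemma cond_prob_ge0 P A X x : 0 <= cond_prob P A X x.
Proof. by rewrite divr_ge0 ?fine_ge0. Qed.

Lemma cond_prob_le1 P A X x : measurable A -> cond_prob P A X x <= 1.
Proof.
move=> mA; have mX := measurable_event_eq X x.
rewrite /cond_prob.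
(* On a null outcome the quotient takes the default value 0, which respects the bound. *)
have [->|Pneq0] := eqVneq (fine (P (event_eq X x))) 0.
  by rewrite invr0 mulr0.
rewrite ler_pdivrMr ?lt0r ?Pneq0 ?fine_ge0 // mul1r.
rewrite fine_le ?fin_num_measure //; first exact: measurableI.
exact: measureIr.
Qed.

(** Up to a null set, [A] is the disjoint union of its traces on the events {X = x} with x in [J];
    finite additivity applies, and non-nullness lets each denominator cancel. *)
Lemma total_probability_finite P A X J :
  measurable A -> finite_set J -> P (X @^-1` J) = 1%E ->
  (forall x, J x -> P (event_eq X x) != 0%E) ->
  fine (P A) = \sum_(x \in J) cond_prob P A X x * fine (P (event_eq X x)).
Proof.
move=> mA finJ PJ1 Jneq0; have mX := measurable_event_eq X.
have XJE : X @^-1` J = \bigcup_(x in J) event_eq X x.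
  rewrite /event_eq -preimage_bigcup; congr (_ @^-1` _).
  by apply/seteqP; split=> [x Jx|_ [x Jx ->] //]; exists x.
have mXJ : measurable (X @^-1` J) by rewrite XJE; exact: fin_bigcup_measurable.
have mAX x : measurable (A `&` event_eq X x) by exact: measurableI.
rewrite -(@probability_setI_sure P A (X @^-1` J)) // XJE setI_bigcupr.
rewrite measure_fin_bigcup //; last exact: trivIset_preimage1_in.
transitivity (fine (\sum_(x \in J)
    (cond_prob P A X x * fine (P (event_eq X x)))%:E)%E);
  last by rewrite fsumEFin.
congr fine; apply: eq_fsbigr => x /set_mem Jx.
have Xfin : P (event_eq X x) \is a fin_num by exact: fin_num_measure.
rewrite divfK ?fineK ?fin_num_measure //.
by apply: contra (Jneq0 x Jx) => /eqP Px0; rewrite -(fineK Xfin) Px0.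
Qed.

Lemma total_probability_le_ge P A X J m M :
  measurable A -> finite_set J -> P (X @^-1` J) = 1%E ->
  (forall x, J x -> P (event_eq X x) != 0%E) ->
  (forall x, J x -> m <= cond_prob P A X x) ->
  (forall x, J x -> cond_prob P A X x <= M) ->
  m <= fine (P A) <= M.
Proof.
move=> mA finJ PJ1 Jneq0 mle leM.
(* The weights of the average sum to 1: this is total probability for the sure event, whose
   conditional probability given a non-null outcome is 1. *)
have sum1 : \sum_(x \in J) fine (P (event_eq X x)) = 1.
  transitivity (fine (P setT)); last by rewrite probability_setT.
  rewrite (@total_probability_finite P setT X J) //.
  apply: eq_fsbigr => x /set_mem Jx; rewrite /cond_prob setTI.
  have [->|Pneq0] := eqVneq (fine (P (event_eq X x))) 0; first by rewrite mulr0.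
  by rewrite divff ?mul1r.
rewrite (@total_probability_finite P A X J) //.
rewrite -[m]mulr1 -[M]mulr1 -sum1 !mulr_fsumr !fsbig_finite //=.
rewrite !big_seq; apply/andP; split; apply: ler_sum => x;
  rewrite in_fset_set // => /set_mem Jx; rewrite ler_wpM2r ?fine_ge0 //.
- exact: mle.
- exact: leM.
Qed.

End ConditionalMeans.

Theorem proposition5 (d : measure_display) (T : measurableType d) (R : realType)
  (PP : set (probability T R)) (A : set T) (X : {mfun T >-> R})
  (hPP : PP !=set0) (hA : measurable A)
  (hnull : agree_on_null PP X) (hX : simple_rv PP X) :
  ~ weakly_pointwise_constricts PP X A.
Proof.
case: hX => I finI PI1 [S [mS PS1 Sneq0] constricts].
(* [J] is finite thanks to [I], free of null outcomes thanks to [S], and of probability 1 as an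
   intersection of two sure sets. *)
pose J := S `&` I.
have finJ : finite_set J by exact: finite_setIr.
have JS x : J x -> S x by case.
have mI : measurable I.
  exact: countable_measurable (finite_set_countable finI).
have PJ1 P : PP P -> P (X @^-1` J) = 1%E.
  move=> PPP; rewrite preimage_setI probability_setI_sure ?PI1 ?PS1 //;
    by rewrite -[_ @^-1` _]setTI; exact: measurable_funPT.
have Jneq0 P : PP P -> forall x, J x -> P (event_eq X x) != 0%E.
  by move=> PPP x /JS Sx; exact: Sneq0.
(* A real [inf] or [sup] is a genuine bound only for a bounded set; 0 and 1 bound all conditional
   probabilities. *)
have lbcond P x : PP P -> lower_cond PP A X x <= cond_prob P A X x.
  move=> PPP; apply: ge_inf; last by exists P.
  by exists 0 => _ [Q _ <-]; exact: cond_prob_ge0.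
have ubcond P x : PP P -> cond_prob P A X x <= upper_cond PP A X x.
  move=> PPP; apply: ub_le_sup; last by exists P.
  by exists 1 => _ [Q _ <-]; exact: cond_prob_le1.
have [P0 PP0] := hPP.
have PA0 : [set fine (P A) | P in PP] !=set0 by exists (fine (P0 A)), P0.
case: constricts => [lo|up].
- have [|m ltm mle] :=
    @finite_gt_bound _ _ J (lower_cond PP A X) (lower_prob PP A) finJ.
  + by move=> x /JS/lo[].
  suff : m <= lower_prob PP A by rewrite leNgt ltm.
  apply: lb_le_inf => // _ [P PPP <-].
  (* The trivial bound 1 only completes the two-sided estimate. *)
  suff /andP[] : m <= fine (P A) <= 1 by [].
  apply: (@total_probability_le_ge _ _ _ P A X J) => //.
  + exact: PJ1.
  + exact: Jneq0.
  + by move=> x Jx; rewrite (le_trans (mle x Jx)) // lbcond.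
  + by move=> x _; exact: cond_prob_le1.
(* Negation reduces the dual case to the same lemma: [- m] is a uniform bound on the upper
   conditional probabilities, strictly below the upper probability of [A]. *)
- have [|m ltm mle] :=
    @finite_gt_bound _ _ J (fun x => - upper_cond PP A X x)
      (- upper_prob PP A) finJ.
  + by move=> x /JS/up[_]; rewrite ltrN2.
  suff : upper_prob PP A <= - m by rewrite leNgt ltrNl ltm.
  apply: ge_sup => // _ [P PPP <-].
  suff /andP[] : 0 <= fine (P A) <= - m by [].
  apply: (@total_probability_le_ge _ _ _ P A X J) => //.
  + exact: PJ1.
  + exact: Jneq0.
  + by move=> x _; exact: cond_prob_ge0.
  + by move=> x Jx; rewrite (le_trans (ubcond P x PPP)) // lerNr mle.
Qed.
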